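(* Let $X$ be a CAT(0) space and let $g$ be a parabolic isometry of $X$ with $\tau(g)>0$. Then: - $g$ is contracting if and only if there exists $x\in X$ such that the geodesic segments $[x,g^nx]$ are uniformly contracting as $n\to\infty$ (i.e. there is a constant $C$ such that $[x,g^nx]$ is $C$-contracting for every $n\geq 1$). - If we further assume that $X$ is complete and proper, then $g$ is not contracting.
   Context: For an isometry $g$ of a metric space $(X,d)$, the translation length is $\tau(g)=\lim_{n\to\infty}d(x,g^nx)/n$ (independent of $x$), and $\mathrm{Min}(g)=\{x\in X: d(x,gx)=\tau(g)\}$. An isometry $g$ of a CAT(0) space is parabolic if $\mathrm{Min}(g)=\varnothing$. A subset $A\subset X$ is $C$-contracting if for any open ball $B$ disjoint from $A$, the closest point projection $\pi_A(B)$ has diameter at most $C$. An isometry $g$ of $X$ is contracting if there is $x\in X$ such that $n\mapsto g^nx$ is a quasi-isometric embedding $\mathbb{Z}\to X$ and the orbit $\{g^nx:n\in\mathbb{Z}\}$ is $C$-contracting for some $C$. For $x,y\in X$, $[x,y]$ denotes the unique CAT(0) geodesic segment from $x$ to $y$. *)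

(* Defs.v *)
From HB Require Import structures.
From mathcomp Require Import all_boot all_order all_algebra.
From mathcomp Require Import all_classical all_reals all_analysis.

Set Implicit Arguments.
Unset Strict Implicit.
Unset Printing Implicit Defensive.

Import Order.TTheory GRing.Theory Num.Theory.
Import numFieldNormedType.Exports.

Local Open Scope classical_set_scope.
Local Open Scope ring_scope.

Definition geodesic_path (R : realType) (X : metricType R) (x y : X)
    (c : R -> X) : Prop :=
  [/\ c 0 = x, c (mdist x y) = y &
      {in `[0, mdist x y] &, forall s t, mdist (c s) (c t) = `|s - t|}].

Definition geodesic_segment (R : realType) (X : metricType R) (x y : X)
    (S : set X) : Prop :=
  exists2 c, geodesic_path x y c & S = c @` `[0, mdist x y]%classic.

(* [x, y]: "the" geodesic segment, meaningful when it exists and is unique,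
   as in a CAT(0) space (junk value set0 when there is none). *)
Definition segment (R : realType) (X : metricType R) (x y : X) : set X :=
  xget set0 [set S | geodesic_segment x y S].

(* The Euclidean plane is R * R with this distance: the library distance on
   R * R and on 'rV[R]_2 is the sup distance. *)
Definition eucl_dist (R : realType) (p q : R * R) : R :=
  Num.sqrt ((p.1 - q.1) ^+ 2 + (p.2 - q.2) ^+ 2).

Definition eucl_segment (R : realType) (p q : R * R) : set (R * R) :=
  [set z | exists2 t : R, 0 <= t <= 1 &
     z = ((1 - t) * p.1 + t * q.1, (1 - t) * p.2 + t * q.2)].

(* Vertices are indexed cyclically by 'I_3; the i-th side joins v i to
   v (ordS i), where ordS is the cyclic successor. *)
Definition geodesic_triangle (R : realType) (X : metricType R)
    (v : 'I_3 -> X) (side : 'I_3 -> set X) : Prop :=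
  forall i, geodesic_segment (v i) (v (ordS i)) (side i).

Definition comparison_triangle (R : realType) (X : metricType R)
    (v : 'I_3 -> X) (w : 'I_3 -> R * R) : Prop :=
  forall i, eucl_dist (w i) (w (ordS i)) = mdist (v i) (v (ordS i)).

(* z is the comparison point of x, seen as a point of the i-th side. *)
Definition comparison_point (R : realType) (X : metricType R)
    (v : 'I_3 -> X) (w : 'I_3 -> R * R) (i : 'I_3) (x : X) (z : R * R)
    : Prop :=
  eucl_segment (w i) (w (ordS i)) z /\ eucl_dist (w i) z = mdist (v i) x.

Definition CAT0 (R : realType) (X : metricType R) : Prop :=
  (forall x y : X, exists S, geodesic_segment x y S) /\
  (forall (v : 'I_3 -> X) (side : 'I_3 -> set X) (w : 'I_3 -> R * R),
    geodesic_triangle v side -> comparison_triangle v w ->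
    forall (i j : 'I_3) (x y : X) (x' y' : R * R),
      side i x -> side j y ->
      comparison_point v w i x x' -> comparison_point v w j y y' ->
      mdist x y <= eucl_dist x' y').

Record self_isometry (R : realType) (X : metricType R) := SelfIsometry {
  isom_fun :> X -> X;
  isom_inv : X -> X;
  isom_funK : cancel isom_fun isom_inv;
  isom_invK : cancel isom_inv isom_fun;
  isom_dist : forall x y, mdist (isom_fun x) (isom_fun y) = mdist x y }.

Definition isom_exp (R : realType) (X : metricType R) (g : self_isometry X)
    (n : int) (x : X) : X :=
  match n with
  | Posz k => iter k g x
  | Negz k => iter k.+1 (isom_inv g) x
  end.

(* The limit of d(x, g^n x) / n exists and does not depend on x, so at most
   one t qualifies as soon as X is nonempty, and one does. *)
Definition translation_length (R : realType) (X : metricType R)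
    (g : self_isometry X) : R :=
  xget 0 [set t : R | forall x : X,
    (fun n : nat => mdist x (isom_exp g n x) / n%:R) @ \oo --> t].

Definition Min (R : realType) (X : metricType R) (g : self_isometry X) : set X :=
  [set x | mdist x (g x) = translation_length g].

Definition parabolic (R : realType) (X : metricType R) (g : self_isometry X)
    : Prop :=
  Min g = set0.

(* Set-valued: a point may have several closest points in A, or none. *)
Definition closest_proj (R : realType) (X : metricType R) (A B : set X)
    : set X :=
  [set a | A a /\ exists2 b, B b & forall a', A a' -> mdist b a <= mdist b a'].

Definition contracting_set (R : realType) (X : metricType R) (C : R)
    (A : set X) : Prop :=
  forall (c : X) (r : R), ball c r `&` A = set0 ->
    forall p q, closest_proj A (ball c r) p -> closest_proj A (ball c r) q ->
      mdist p q <= C.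

Definition quasi_isometric_embedding_int (R : realType) (X : metricType R)
    (f : int -> X) : Prop :=
  exists K e : R, [/\ 1 <= K, 0 <= e & forall m n : int,
    K^-1 * `|m - n|%:~R - e <= mdist (f m) (f n) <= K * `|m - n|%:~R + e].

Definition contracting (R : realType) (X : metricType R) (g : self_isometry X)
    : Prop :=
  exists2 x : X, quasi_isometric_embedding_int (fun n => isom_exp g n x) &
    exists C : R, contracting_set C (range (fun n : int => isom_exp g n x)).

Definition complete_space (R : realType) (X : metricType R) : Prop :=
  forall F : set_system X, ProperFilter F -> cauchy F -> exists l : X, F --> l.

(* The library's closed_ball is the closure of the open ball, hence not used. *)
Definition proper_space (R : realType) (X : metricType R) : Prop :=
  forall (x : X) (r : R), compact [set y : X | mdist x y <= r].

(* Main.v *)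
(* A C-contracting set A satisfies two coarse inequalities: a path from b to a
   point of A passes near the projection of b (detour), and points with distant
   projections are joined through those projections (bounded_or_detour). They
   make strong contraction pass to sets that are projected to via A
   (contracting_transfer). As the translation length tau is positive, every
   orbit is a quasi-line, so:
   - if the orbit is contracting, geodesics between its points stay near it,
     and the contraction passes to the segments [x, g^n x];
   - if those segments are contracting, the Morse argument keeps the orbit near
     them, and the contraction passes to the orbit.
   For the last claim, midpoints give points z with d(z, gz) <= tau + e. Convexity
   of the metric keeps this bound along a long geodesic [z, g^n z], which comes
   within 2C of a contracting orbit. Up to translation, near-minimizers of the
   displacement thus stay in one ball, which is compact, so tau is attained and
   g is not parabolic. *)

Require Import Defs.
From mathcomp Require Import all_boot all_order all_algebra.
From mathcomp Require Import all_classical all_reals all_analysis.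
From mathcomp Require Import ring lra zify.

Set Implicit Arguments.
Unset Strict Implicit.
Unset Printing Implicit Defensive.

Import Order.TTheory GRing.Theory Num.Theory.
Import numFieldNormedType.Exports.

Local Open Scope classical_set_scope.
Local Open Scope ring_scope.

Local Notation d := mdist.

(** * Contracting sets *)

Section Contraction.
Context (R : realType) (X : metricType R).
Implicit Types (A B : set X) (a b c p q x y z : X) (C D r s t : R).

Definition nearest A b p : Prop := A p /\ forall a, A a -> d b p <= d b a.

(** Disjointness from the ball becomes a lower bound [r] on distances to [c], ready for linear
    arithmetic. *)
Lemma contracting_setP C A : contracting_set C A <->
  forall c r b1 b2 p q, (forall a, A a -> r <= d c a) ->
    d c b1 < r -> d c b2 < r -> nearest A b1 p -> nearest A b2 q -> d p q <= C.
Proof.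
split=> [h c r b1 b2 p q rA b1r b2r [Ap hp] [Aq hq]|h c r B0 p q].
  apply: (h c r).
  - apply/seteqP; split=> // a [/=]; rewrite ballEmdist/= => car Aa.
    by have := rA _ Aa; rewrite leNgt car.
  - by split=> //; exists b1 => //; rewrite ballEmdist.
  - by split=> //; exists b2 => //; rewrite ballEmdist.
move=> [Ap [b1 b1r hp]] [Aq [b2 b2r hq]].
move: b1r b2r; rewrite ballEmdist/= => b1r b2r.
apply: (h c r b1 b2) => // a Aa; rewrite leNgt; apply/negP => car.
suff : set0 a by [].
by rewrite -B0; split=> //; rewrite ballEmdist.
Qed.

Lemma contracting_set_le C C' A :
  C <= C' -> contracting_set C A -> contracting_set C' A.
Proof. by move=> CC' h c r B0 p q pB qB; apply: le_trans CC'; exact: h pB qB. Qed.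

Lemma nearest_mem A a p : A a -> nearest A a p -> p = a.
Proof.
move=> Aa [_ /(_ a Aa)]; rewrite mdistxx => h; apply/esym/mdist_positivity.
by apply/eqP; rewrite eq_le h mdist_ge0.
Qed.

Lemma path_dist x y (g : R -> X) s t : geodesic_path x y g ->
  0 <= s <= d x y -> 0 <= t <= d x y -> d (g s) (g t) = `|s - t|.
Proof. by case=> _ _ h hs ht; apply: h; rewrite in_itv. Qed.

Lemma path_dist_start x y (g : R -> X) s : geodesic_path x y g ->
  0 <= s <= d x y -> d x (g s) = s.
Proof.
move=> hc hs; have [<- _ _] := hc.
rewrite (path_dist hc) ?lexx ?mdist_ge0//.
by rewrite sub0r normrN ger0_norm//; case/andP: hs.
Qed.

Lemma path_dist_end x y (g : R -> X) s : geodesic_path x y g ->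
  0 <= s <= d x y -> d (g s) y = d x y - s.
Proof.
move=> hc hs; have [_ e _] := hc.
rewrite -[in LHS]e (path_dist hc) ?lexx ?mdist_ge0//.
by rewrite distrC ger0_norm//; lra.
Qed.

Context (geo : forall x y, exists g, geodesic_path x y g).

Lemma point_at x y s : 0 <= s <= d x y -> exists z, d x z = s /\ d z y = d x y - s.
Proof.
by move=> hs; have [g hc] := geo x y; exists (g s);
  rewrite (path_dist_start hc hs) (path_dist_end hc hs).
Qed.

(** Jumps of [m] indices cost [C] each; the extra 1 pays for a last, shorter jump. *)
Lemma walk (q : nat -> X) C (m s e : nat) : (0 < m)%N -> 0 <= C ->
  (forall i j : nat, (s <= i < e)%N -> (i <= j <= i + m)%N -> d (q i) (q j) <= C) ->
  (s <= e)%N -> d (q s) (q e) <= C * ((e - s)%:R / m%:R + 1).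
Proof.
move=> m0 C0; have mR : 0 < m%:R :> R by rewrite ltr0n.
have [l] := ubnP (e - s); elim: l s => // l IH s ls h se.
have [small|big] := leqP e (s + m).
  apply: (@le_trans _ _ C).
    move: se; rewrite leq_eqVlt => /orP[/eqP->|se]; first by rewrite mdistxx.
    by apply: h; lia.
  by rewrite ler_peMr// lerDr divr_ge0.
have ise : (s + m <= e)%N by lia.
have step : d (q s) (q (s + m)%N) <= C by apply: h; lia.
have IHs : d (q (s + m)%N) (q e) <= C * ((e - (s + m))%:R / m%:R + 1).
  by apply: IH => //; [lia | move=> i j ie ij; apply: h => //; lia].
have -> : (e - s)%:R / m%:R = (e - (s + m))%:R / m%:R + 1 :> R.
  have -> : (e - s = (e - (s + m)) + m)%N by lia.
  by rewrite natrD mulrDl divff// gt_eqF.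
have := metric_triangle (q s) (q (s + m)%N) (q e).
by nra.
Qed.

Section ContractingSet.
Context (A : set X) (C : R) (C_gt0 : 0 < C) (ctrA : contracting_set C A).
Context (near : forall b, exists p, nearest A b p).

(** The open ball around [b] of radius [d b p] misses [A] and contains both [b] and [y]. *)
Lemma drift b y p q : nearest A b p -> nearest A y q -> d b y < d b p ->
  d p q <= C.
Proof.
move=> hp hq byp; move/contracting_setP: ctrA; apply;
  [exact: hp.2| |exact: byp|exact: hp|exact: hq].
by rewrite mdistxx (le_lt_trans _ byp)// mdist_ge0.
Qed.

(** As [C > 0], the bound on [d b y] is below [d b p] unless [b] lies in [A], and then [y = b]. *)
Lemma drift_shrink b y p q : nearest A b p -> nearest A y q ->
  d b y <= Num.max 0 (d b p - C) -> d p q <= C.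
Proof.
have C0 := C_gt0.
move=> hp hq; have [bp0|bp0 byp] := leP (d b p) 0.
  have -> : p = b by apply/esym/mdist_positivity/le_anti; rewrite bp0 mdist_ge0.
  rewrite mdistxx; have -> : Num.max 0 (0 - C) = 0.
    by apply/max_idPl; rewrite sub0r oppr_le0 ltW.
  move=> by0; have yb : y = b.
    by apply/esym/mdist_positivity/le_anti; rewrite by0 mdist_ge0.
  have Ab : A b.
    have <- : p = b by apply/esym/mdist_positivity/le_anti; rewrite bp0 mdist_ge0.
    by case: hp.
  by rewrite yb in hq; rewrite (nearest_mem Ab hq) mdistxx ltW.
apply: drift hp hq _; apply: le_lt_trans byp _.
by rewrite gt_max bp0 gtrBl.
Qed.

(* Induction on d b a, moving b towards a by d b p - C: either the new point is
   still at distance 2 C from A, and the gain pays for the drift of its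
   projection, or b was already close to A. *)
Lemma detour b p a : nearest A b p -> A a -> d b p + d p a <= d b a + 4 * C.
Proof.
have C0 := C_gt0.
move=> hp Aa; have [n] := ubnP (Num.trunc (d b a / C)).
elim: n b p hp => // n IH b p hp ban.
have [bp2|bp2] := leP (d b p) (2 * C).
  have := metric_triangle p b a; rewrite (metric_sym p b); lra.
have ba : d b p <= d b a by exact: hp.2.
have [z [bz za]] : exists z, d b z = d b p - C /\ d z a = d b a - (d b p - C).
  by apply: point_at; lra.
have [q hq] := near z.
have pq : d p q <= C by apply: drift hp hq _; rewrite bz; lra.
have := metric_triangle p q a.
have [zq2|zq2] := leP (d z q) (2 * C).
  have := metric_triangle q z a; rewrite (metric_sym q z); lra.
have : d z q + d q a <= d z a + 4 * C; last by lra.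
apply: IH => //; rewrite -ltnS; apply: leq_trans ban; rewrite ltnS.
(* Since [d b p > 2 * C], the move is longer than [C], so the truncated quotient drops. *)
have zaC : d z a / C <= d b a / C - 1.
  rewrite za -[X in _ <= _ - X](@divff _ C) ?gt_eqF// -mulrBl ler_pM2r ?invr_gt0//; lra.
have z0 : 0 <= d z a / C by rewrite divr_ge0 ?mdist_ge0// ltW.
rewrite truncn_ge_nat.
  by rewrite -natr1; have /andP[] := truncn_itv z0; lra.
by rewrite divr_ge0 ?mdist_ge0 ?ltW.
Qed.

(** If the geodesic stays farther than [2 * C] from [A], each step of length [2 * C] moves the
    projection by at most [C], hence the factor 1/2. *)
Lemma approach_or_shrink b c p q (g : R -> X) : geodesic_path b c g ->
  nearest A b p -> nearest A c q ->
  (exists s a, [/\ 0 <= s <= d b c, A a & d (g s) a <= 2 * C]) \/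
  d p q <= d b c / 2 + 4 * C.
Proof.
have C0 := C_gt0.
move=> hg hp hq; have [hex|hno] := pselect (exists s a,
  [/\ 0 <= s <= d b c, A a & d (g s) a <= 2 * C]); [by left|right].
have far s a : 0 <= s <= d b c -> A a -> 2 * C < d (g s) a.
  move=> hs Aa; rewrite ltNge; apply/negP => le2.
  by apply: hno; exists s, a.
pose u (i : nat) : R := Num.min (2 * C * i%:R) (d b c).
have uP i : 0 <= u i <= d b c.
  by rewrite /u ge_min lexx orbT andbT le_min mdist_ge0 andbT mulr_ge0//; lra.
have [f hf] := choice (fun i => near (g (u i))).
pose e := (Num.trunc (d b c / (2 * C))).+1.
have L0 : 0 <= d b c / (2 * C) by rewrite divr_ge0 ?mdist_ge0//; lra.
have [eL Le] : e%:R <= d b c / (2 * C) + 1 /\ d b c / (2 * C) < e%:R.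
  rewrite /e; have /andP[h1 h2] := truncn_itv L0; split=> //.
  by rewrite -natr1 lerD2r.
have stepu i : `|u i - u i.+1| <= 2 * C.
  rewrite /u -[i.+1%:R]natr1 mulrDr mulr1; set v := 2 * C * i%:R.
  by rewrite ler_norml; case: (leP v); case: (leP (v + 2 * C)); lra.
have := @walk f C 1 0 e isT (ltW C_gt0) _ isT.
have stepf (i j : nat) : (0 <= i < e)%N -> (i <= j <= i + 1)%N -> d (f i) (f j) <= C.
  move=> _ /andP[ij ji]; have [->|->] : j = i \/ j = i.+1 by lia.
    by rewrite mdistxx ltW.
  apply: drift (hf _) (hf _) _; rewrite (path_dist hg)//.
  by apply: le_lt_trans (stepu i) _; apply: far => //; case: (hf i).
move=> /(_ stepf); rewrite subn0 divr1 => pe.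
(* [g (u 0)] is [b], but its chosen projection may differ from [p]; likewise at [c]. *)
have p0 : d p (f 0%N) <= C.
  apply: (drift_shrink hp (hf 0%N)).
  rewrite (path_dist_start hg)// /u mulr0 le_max.
  by apply/orP; left; rewrite ge_min lexx.
have qe : d q (f e) <= C.
  apply: (drift_shrink hq (hf e)); rewrite metric_sym (path_dist_end hg)//.
  rewrite le_max; apply/orP; left; rewrite /u.
  move: Le; rewrite ltr_pdivrMr; last by lra.
  by move=> Le; rewrite min_r ?subrr// mulrC ltW.
have e1 : C * (e%:R + 1) <= d b c / 2 + 2 * C.
  have := ler_wpM2l (ltW C_gt0) eL; rewrite invfM mulrA.
  have -> : C * (d b c / 2 / C + 1) = d b c / 2 + C by field; rewrite gt_eqF.
  by lra.
have := metric_triangle p (f 0%N) q; have := metric_triangle (f 0%N) (f e) q.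
by rewrite (metric_sym (f e) q); lra.
Qed.

(** Cut off end pieces of lengths [s1] and [s2], along which the projection moves by at most [C]. If
    the middle piece comes near some [a] in [A], [detour] from [b] and from [c] to [a] gives the
    second alternative. Otherwise the projection halves its length, which is at most
    [d p q + 2 * C], so [d p q] is bounded. *)
Lemma bounded_or_detour b c p q : nearest A b p -> nearest A c q ->
  d p q <= 14 * C \/ d b p + d p q + d q c <= d b c + 12 * C.
Proof.
have C0 := C_gt0.
move=> hp hq.
pose s1 := Num.max 0 (d b p - C); pose s2 := Num.max 0 (d c q - C).
have [s10 s1p] : 0 <= s1 /\ d b p - C <= s1 by rewrite !le_max !lexx orbT.
have [s20 s2q] : 0 <= s2 /\ d c q - C <= s2 by rewrite !le_max !lexx orbT.
have s1p' : s1 <= d b p by rewrite ge_max mdist_ge0; lra.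
have s2q' : s2 <= d c q by rewrite ge_max mdist_ge0; lra.
have [short|long] := leP (d b c) (s1 + s2).
  (* The end pieces overlap, so one point [z] projects near both [p] and [q]. *)
  left; have [|z [bz zc]] := @point_at b c (Num.min s1 (d b c)).
    by rewrite le_min s10 mdist_ge0 ge_min lexx orbT.
  have [u hu] := near z.
  have pu : d p u <= C by apply: drift_shrink hp hu _; rewrite bz ge_min lexx.
  have qu : d q u <= C.
    apply: drift_shrink hq hu _; rewrite metric_sym zc.
    by rewrite -/s2; case: (leP s1 (d b c)); lra.
  by have := metric_triangle p u q; rewrite (metric_sym u q); lra.
have [|b' [bb' b'c]] := @point_at b c s1; first by lra.
have [|c' [b'c' c'c]] := @point_at b' c (d b' c - s2); first by lra.
have [p' hp'] := near b'; have [q' hq'] := near c'.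
have pp' : d p p' <= C by apply: drift_shrink hp hp' _; rewrite bb'.
have qq' : d q q' <= C.
  by apply: drift_shrink hq hq' _; rewrite metric_sym c'c -/s2; lra.
have [g hg] := geo b' c'.
have [[s [a [hs Aa sa]]]|pq'] := approach_or_shrink hg hp' hq'.
  right; have gb := path_dist_start hg hs; have gc := path_dist_end hg hs.
  have := detour hp Aa; have := detour hq Aa.
  have := metric_triangle b b' (g s); have := metric_triangle b (g s) a.
  have := metric_triangle (g s) c' c; have := metric_triangle c (g s) a.
  have := metric_triangle p a q.
  rewrite (metric_sym c (g s)) (metric_sym a q) (metric_sym q c); lra.
left; have := metric_triangle p p' q; have := metric_triangle p' q' q.
rewrite (metric_sym q' q).
have := metric_triangle b p q; have := metric_triangle b q c.
rewrite (metric_sym q c); lra.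
Qed.

(* B is contracting as soon as projecting to B amounts to projecting to A and
   then moving along the relation F, which is the identity when B is at finite
   Hausdorff distance from A, and the clamping of indices when B is near a
   finite piece of an orbit A. *)
Lemma contracting_transfer B (F : X -> X -> Prop) D M : 0 <= D ->
  (forall a, A a -> exists f, F a f) ->
  (forall a f, A a -> F a f -> exists2 y, B y & d f y <= D) ->
  (forall y, B y -> exists2 a, A a & d y a <= D /\
     forall a' f, A a' -> F a' f -> d a' f + d f a <= d a' a + D) ->
  (forall a a' f f', A a -> A a' -> F a f -> F a' f' ->
     d a a' <= d a f + 14 * C + D -> d f f' <= M) ->
  contracting_set (2 * (M + 4 * C + 4 * D)) B.
Proof.
have C0 := C_gt0.
move=> D0 FE FB BF FF; apply/contracting_setP => c r.
(* All projections from the ball to [B] are compared with one [f], related by [F] to a projection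
   [q] of the centre; hence the factor 2. *)
suff key b p q f : (forall y, B y -> r <= d c y) -> nearest A c q -> F q f ->
    d c b < r -> nearest B b p -> d p f <= M + 4 * C + 4 * D.
  move=> b1 b2 p1 p2 rB h1 h2 hp1 hp2; have [q hq] := near c.
  have [f qf] := FE _ hq.1.
  have := key _ _ _ _ rB hq qf h1 hp1; have := key _ _ _ _ rB hq qf h2 hp2.
  by have := metric_triangle p1 f p2; rewrite (metric_sym f p2); lra.
move=> rB hq qf cb [Bp hp]; have [u hu] := near b.
have [e ue] := FE _ hu.1.
have [y By ey] := FB _ _ hu.1 ue; have bpy := hp _ By.
have [a Aa [pa /(_ _ _ hu.1 ue) uea]] := BF _ Bp.
have [w Bw fw] := FB _ _ hq.1 qf; have rw := rB _ Bw.
(* The route from [b] through [u] and [e] to [a], a point near [p], is almost geodesic, while [B]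
   passes near [e] and is no closer to [b] than [p]. *)
have ep : d e p <= 4 * C + 4 * D.
  have := detour hu Aa; have := metric_triangle b p a.
  have := metric_triangle b u y; have := metric_triangle u e y.
  by have := metric_triangle e a p; rewrite (metric_sym a p); lra.
have cw := metric_triangle c q w; have qw := metric_triangle q f w.
(* [B] misses the ball but has a point within [d q f + D] of [q], so [d c b < d c q + d q f + D]; a
   detour through [q] and [u] then bounds [d q u]. *)
have qu : d q u <= d q f + 14 * C + D.
  have := mdist_ge0 q f; have := mdist_ge0 u b.
  by have [] := bounded_or_detour hq hu; lra.
have fe := FF _ _ _ _ hq.1 hu.1 qf ue qu.
have := metric_triangle p e f; rewrite (metric_sym p e) (metric_sym e f).
by lra.
Qed.

End ContractingSet.
End Contraction.

(** * Contracting quasi-lines *)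

Section Sequences.
Context (R : realType).

Lemma finite_argmin (h : nat -> R) n :
  exists2 k, (k <= n)%N & forall j : nat, (j <= n)%N -> h k <= h j.
Proof.
elim: n => [|n [k kn hk]].
  by exists 0%N => // j; rewrite leqn0 => /eqP->.
have [le|lt] := leP (h k) (h n.+1).
  exists k; first by rewrite ltnW.
  by move=> j; rewrite leq_eqVlt => /orP[/eqP->|/hk].
exists n.+1 => // j; rewrite leq_eqVlt => /orP[/eqP->//|/hk].
exact: le_trans (ltW lt).
Qed.

(** Take the first index at which [u] reaches [v]; only upward jumps matter. *)
Lemma discrete_ivt (u : nat -> R) (v J : R) m : 0 <= J -> u 0%N <= v <= u m ->
  (forall l, (l < m)%N -> u l.+1 - u l <= J) ->
  exists2 l, (l <= m)%N & `|u l - v| <= J.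
Proof.
move=> J0 /andP[u0 um] step.
have ex : exists l, v <= u l by exists m.
have [[|l] vl min] := ex_minnP ex.
  by exists 0%N => //; rewrite ler_norml; lra.
have lm : (l < m)%N by exact: min um.
exists l.+1 => //; have := step _ lm.
have : u l < v by rewrite ltNge; apply/negP => /min; rewrite ltnn.
by rewrite ler_norml; lra.
Qed.

End Sequences.

Section QuasiLine.
Context (R : realType) (X : metricType R).
Context (geo : forall x y : X, exists g, geodesic_path x y g).
Context (f : int -> X) (tau lam : R) (tau_gt0 : 0 < tau).
Context (f_lower : forall i j, tau * `|i - j|%:~R <= d (f i) (f j)).
Context (f_upper : forall i j, d (f i) (f j) <= lam * `|i - j|%:~R).
Implicit Types (x y z p : X) (i j k : int) (C D s t : R).

Lemma lam_ge0 : 0 <= lam.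
Proof.
have := f_upper 1 0; have := mdist_ge0 (f 1) (f 0).
by rewrite subr0 normr1 mulr1; exact: le_trans.
Qed.

Lemma index_dist i j D : d (f i) (f j) <= D -> `|i - j|%:~R <= D / tau.
Proof.
by move=> h; rewrite ler_pdivlMr// mulrC; exact: le_trans (f_lower i j) h.
Qed.

Lemma f_close i j D : `|i - j|%:~R <= D -> d (f i) (f j) <= lam * D.
Proof.
by move=> h; apply: le_trans (f_upper i j) _; rewrite ler_wpM2l// lam_ge0.
Qed.

(** By [f_lower], indices beyond [N] give points no closer to [x] than [f 0], so a finite window
    suffices. *)
Lemma nearest_range x : exists p, nearest (range f) x p.
Proof.
pose N := (Num.trunc (2 * d x (f 0) / tau)).+1.
have NP : 2 * d x (f 0) < tau * N%:R.
  rewrite [ltRHS]mulrC -ltr_pdivrMr//.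
  have q0 : 0 <= 2 * d x (f 0) / tau by rewrite divr_ge0 ?mulr_ge0 ?mdist_ge0 ?ltW.
  by have /andP[] := truncn_itv q0.
have [l ln hl] := finite_argmin (fun l => d x (f (l%:Z - N%:Z))) (N + N).
exists (f (l%:Z - N%:Z)); split=> [|_ [i _ <-]]; first by exists (l%:Z - N%:Z).
have [small|big] := leP `|i| N%:Z.
  have -> : i = `|(i + N%:Z)%R|%N%:Z - N%:Z by lia.
  by apply: hl; lia.
have := hl N ltac:(lia); rewrite subrr.
have := f_lower i 0; rewrite subr0.
have : tau * N%:R <= tau * `|i|%:~R.
  by rewrite ler_pM2l// -[N%:R]/(N%:Z%:~R) ler_int ltW.
have := metric_triangle (f i) x (f 0); rewrite (metric_sym (f i) x).
lra.
Qed.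

Section ContractingLine.
Context (C : R) (C_gt0 : 0 < C) (ctr : contracting_set C (range f)).

(** Samples at distance at most 1 on a geodesic have projections at most [8 * C + 1] apart, so their
    indices differ by at most [(8 * C + 1) / tau]. *)
Let D1 := 4 * C + lam * ((8 * C + 1) / tau).

Lemma D1_ge0 : 0 <= D1.
Proof.
have C0 := C_gt0; apply: addr_ge0; first by lra.
apply: mulr_ge0; first exact: lam_ge0.
by apply: divr_ge0; [lra|exact: ltW].
Qed.

(** Add the inequalities of [detour] from [y] to [f i] and to [f k]. *)
Lemma line_quasiconvex i k y p : d (f i) y + d y (f k) = d (f i) (f k) ->
  nearest (range f) y p -> d y p <= 4 * C.
Proof.
move=> hy hp; have rf j : range f (f j) by exists j.
have h j : d y p + d p (f j) <= d y (f j) + 4 * C.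
  exact: (detour geo C_gt0 ctr nearest_range hp (rf j)).
have := h i; have := h k; have := metric_triangle (f i) p (f k).
rewrite (metric_sym (f i) p) (metric_sym y (f i)); lra.
Qed.

(** The indices of the projections of successive samples run from [i] to [k] with bounded jumps, so
    one of them is close to [j]. *)
Lemma line_near_path i j k (g : R -> X) : i <= j <= k ->
  geodesic_path (f i) (f k) g ->
  exists2 s, 0 <= s <= d (f i) (f k) & d (g s) (f j) <= D1.
Proof.
have C0 := C_gt0; move=> ijk hg; pose L := d (f i) (f k).
have L0 : 0 <= L by exact: mdist_ge0.
pose t (l : nat) : R := Num.min l%:R L.
have tP l : 0 <= t l <= L by rewrite /t le_min ler0n L0 ge_min lexx orbT.
have stept l : `|t l.+1 - t l| <= 1.
  rewrite /t -[l.+1%:R]natr1; set v := l%:R : R.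
  by rewrite ler_norml; case: (leP v); case: (leP (v + 1)); lra.
have [l|u hu] := choice (_ : forall l, exists j, nearest (range f) (g (t l)) (f j)).
  have [p hp] := nearest_range (g (t l)).
  by case: (hp) => -[a _ ap] _; exists a; rewrite ap.
have up l : d (g (t l)) (f (u l)) <= 4 * C.
  apply: (@line_quasiconvex i k); last exact: hu.
  by rewrite (path_dist_start hg)// (path_dist_end hg)// subrKC.
(* The ends of the path project to themselves, and [f_lower] makes [f] injective, which pins down
   their indices. *)
have gE0 a j' : g a = f j' -> forall l, t l = a -> u l = j'.
  move=> ga l ta; have := hu l; rewrite ta ga => h.
  have fj : f (u l) = f j' by apply: nearest_mem h; exists j'.
  apply/eqP; rewrite -subr_eq0 -normr_eq0.
  have := f_lower (u l) j'; rewrite fj mdistxx pmulr_rle0// -[0]/(0%:~R) ler_int.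
  by rewrite normr_le0 normr_eq0.
have [g0 gL _] := hg.
pose m := (Num.trunc L).+1.
have mL : L <= m%:R by have /andP[_ /ltW] := truncn_itv L0.
have u0 : u 0%N = i by apply: gE0 g0 _ _; rewrite /t min_l.
have um : u m = k by apply: gE0 gL _ _; rewrite /t min_r.
pose J := (8 * C + 1) / tau.
have J0 : 0 <= J by rewrite divr_ge0 ?ltW//; lra.
have [||l lm ul] := @discrete_ivt R (fun l => (u l)%:~R) j%:~R J m J0.
- by rewrite u0 um !ler_int.
- move=> l lm; apply: le_trans (ler_norm _) _.
  rewrite -rmorphB/= -intr_norm; apply: index_dist.
  have := up l; have := up l.+1.
  have := path_dist hg (tP l.+1) (tP l); have := stept l.
  have := metric_triangle (f (u l.+1)) (g (t l.+1)) (f (u l)).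
  have := metric_triangle (g (t l.+1)) (g (t l)) (f (u l)).
  rewrite (metric_sym (f (u l.+1)) (g (t l.+1))); lra.
exists (t l) => //; apply: le_trans (metric_triangle _ (f (u l)) _) _.
by rewrite lerD ?up// f_close//; move: ul; rewrite -rmorphB/= -intr_norm.
Qed.

Lemma line_between i j k : (i <= j <= k) || (k <= j <= i) ->
  d (f i) (f j) + d (f j) (f k) <= d (f i) (f k) + 2 * D1.
Proof.
wlog ijk : i k / i <= j <= k => [hw /orP[h|h]|_].
- by apply: (hw i k) => //; rewrite h.
- rewrite addrC metric_sym [d (f i) _]metric_sym [d (f i) (f k)]metric_sym.
  by apply: (hw k i) => //; rewrite h.
have [g hg] := geo (f i) (f k).
have [s hs sj] := line_near_path ijk hg.
have := path_dist_start hg hs; have := path_dist_end hg hs.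
have := metric_triangle (f i) (g s) (f j); have := metric_triangle (f j) (g s) (f k).
rewrite (metric_sym (f j) (g s)); lra.
Qed.

Lemma path_near_line (n : nat) (g : R -> X) s : geodesic_path (f 0) (f n%:Z) g ->
  0 <= s <= d (f 0) (f n) ->
  exists2 i, 0 <= i <= n%:Z & d (g s) (f i) <= 4 * C + 2 * D1.
Proof.
move=> hg hs; have [p hp] := nearest_range (g s).
have gs := path_dist_start hg hs; have ge := path_dist_end hg hs.
have sp : d (g s) p <= 4 * C.
  by apply: (line_quasiconvex (i := 0) (k := n)) hp; rewrite gs ge subrKC.
case: (hp) => -[i _ ip] _; rewrite -ip in sp.
have C0 := C_gt0; have D0 := D1_ge0.
(* An index outside the range is replaced by the nearer end: [line_between] shows that the route
   from [f i] to the other end almost passes through it, so [g s] is close to that end. *)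
have [i0|i0] := leP 0 i; last first.
  exists 0; first by lia.
  have := @line_between i 0 n ltac:(lia).
  have := metric_triangle (f i) (g s) (f n); have := metric_triangle (g s) (f i) (f 0).
  rewrite (metric_sym (f i) (g s)) (metric_sym (g s) (f 0)); lra.
have [iN|iN] := leP i n; first by exists i; [rewrite i0|lra].
exists n%:Z; first by lia.
have := @line_between 0 n i ltac:(lia).
have := metric_triangle (f 0) (g s) (f i); have := metric_triangle (g s) (f i) (f n).
rewrite (metric_sym (f i) (f n)); lra.
Qed.

Lemma contracting_path_of_line : exists C', forall (n : nat) (g : R -> X),
  geodesic_path (f 0) (f n) g ->
  contracting_set C' (g @` `[0, d (f 0) (f n)]).
Proof.
have C0 := C_gt0; have l0 := lam_ge0.
have D10 := D1_ge0.
pose D := 4 * C + 2 * D1; pose M := lam * ((14 * C + 2 * D) / tau).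
exists (2 * (M + 4 * C + 4 * D)) => n g hg.
pose F a e := exists i j, [/\ a = f i, e = f j &
  [/\ 0 <= j <= n%:Z, i < 0 -> j = 0, n%:Z < i -> j = n & 0 <= i <= n%:Z -> j = i]].
apply: (contracting_transfer geo C_gt0 ctr nearest_range (F := F)).
- by rewrite /D; lra.
- move=> _ [i _ <-]; have [i0|i0] := ltP i 0.
    by exists (f 0), i, 0; split=> //; split=> //; lia.
  have [iN|iN] := leP i n.
    by exists (f i), i, i; split=> //; split=> //; lia.
  by exists (f n), i, n%:Z; split=> //; split=> //; lia.
- move=> a e _ [i [j [_ -> [hj _ _ _]]]].
  have [s hs sj] := line_near_path hj hg.
  by exists (g s); [exists s; rewrite // /= in_itv|rewrite metric_sym /D; lra].
- move=> y [s /=]; rewrite in_itv/= => hs <-.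
  have [k hk sk] := path_near_line hg hs.
  exists (f k); first by exists k.
  split=> // a e _ [i [j [-> -> [hj j0 jn ji]]]].
  have := @line_between i j k ltac:(lia); rewrite /D; lra.
move=> a a' e e' _ _ [i [i' [-> -> [hi i0 iN ii]]]] [j [j' [-> -> [hj j0 jN jj]]]] dij.
have M0 : 0 <= M.
  apply: mulr_ge0 => //; apply: divr_ge0; [by rewrite /D; lra|exact: ltW].
(* If the clamped indices differ, [i'] lies between [i] and [j], so [f i'] is close to [f j]; and
   [j'] is no farther from [i'] than [j] is. *)
have [->|ij'] := eqVneq i' j'; first by rewrite mdistxx.
have := @line_between i i' j ltac:(lia).
move=> btw; apply: f_close; apply: (@le_trans _ _ `|i' - j|%:~R).
  by rewrite ler_int; lia.
by apply: index_dist; rewrite /D in dij *; lra.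
Qed.

End ContractingLine.
End QuasiLine.

(** * Quasi-lines along contracting segments *)

Lemma lipschitz_continuous (R : realType) (X : metricType R) (h : X -> R) (K : R) :
  (forall y z, `|h y - h z| <= K * d y z) -> continuous h.
Proof.
move=> hK y; apply/cvgrPdist_lt => e e0.
have K0 : 0 < `|K| + 1 by rewrite ltr_wpDl.
near=> z; apply: le_lt_trans (hK y z) _.
apply: (@le_lt_trans _ _ ((`|K| + 1) * d y z)).
  by rewrite ler_wpM2r ?mdist_ge0// ler_wpDr// ler_norm.
rewrite mulrC -ltr_pdivlMr//; near: z.
apply/metricType_numDomainType.nbhs_mdistP; exists (e / (`|K| + 1)) => //=.
by rewrite divr_gt0.
Unshelve. all: by end_near. Qed.

(** The parameter is clamped by [cl] so that the distance to minimize is continuous on the whole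
    line. *)
Lemma nearest_path (R : realType) (X : metricType R) (x y : X) (g : R -> X) b :
  geodesic_path x y g -> exists p, nearest (g @` `[0, d x y]) b p.
Proof.
move=> hg; pose L := d x y; have L0 : 0 <= L by exact: mdist_ge0.
pose cl (t : R) := Num.max 0 (Num.min t L).
have clP t : 0 <= cl t <= L.
  by rewrite /cl le_max lexx/= ge_max L0 ge_min lexx orbT.
have clid t : 0 <= t <= L -> cl t = t.
  by move=> /andP[t0 tL]; rewrite /cl min_l// max_r.
pose h (t : R^o) : R := d b (g (cl t)).
have hc : continuous h.
  apply: (@lipschitz_continuous _ _ _ 1) => s t; rewrite mul1r.
  apply: (@le_trans _ _ (d (g (cl s)) (g (cl t)))).
    rewrite /h ler_norml.
    have := metric_triangle b (g (cl s)) (g (cl t)).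
    have := metric_triangle b (g (cl t)) (g (cl s)).
    rewrite (metric_sym (g (cl t)) (g (cl s))); lra.
  rewrite (path_dist hg)// /cl; change (d s t) with `|t - s|.
  case: (leP s L) => sL; case: (leP t L) => tL;
    case: (leP 0 s) => s0; case: (leP 0 t) => t0;
    rewrite ?(max_r L0) ?(max_r s0) ?(max_r t0) ?(max_l (ltW s0)) ?(max_l (ltW t0));
    have := ler_norm (s - t); have := ler_norm (t - s); rewrite (distrC s t);
    rewrite ler_norml; lra.
have [u uL hu] := EVT_min L0 (continuous_subspaceT hc).
rewrite in_itv in uL; exists (g u); split.
  by exists u; rewrite //= in_itv.
move=> a [t /=]; rewrite in_itv/= => tL <-.
by have := hu t; rewrite in_itv/= /h !clid//; apply.
Qed.

Lemma distz_nat (R : realType) (i k : nat) : (i <= k)%N ->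
  `|i%:Z - k%:Z|%:~R = (k - i)%:R :> R.
Proof. by move=> ik; rewrite distrC subzn// normr_nat -pmulrn. Qed.

Section MorseOrbit.
Context (R : realType) (X : metricType R).
Context (geo : forall x y : X, exists g, geodesic_path x y g).
Context (f : int -> X) (tau lam : R) (tau_gt0 : 0 < tau).
Context (f_lower : forall i j, tau * `|i - j|%:~R <= d (f i) (f j)).
Context (f_upper : forall i j, d (f i) (f j) <= lam * `|i - j|%:~R).
Context (C : R) (C_gt0 : 0 < C).

(* The orbit loses at most half of its speed tau when projected at distance
   more than rho = m lam, since C / m <= tau / 2. *)
Let m := (Num.trunc (2 * C / tau)).+1.
Let rho := m%:R * lam.
Let W := 2 * (2 * rho + lam + C) / tau.
Let D2 := lam * W + rho.

(* The excursion of f at distance more than rho from A has bounded duration. *)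
Lemma morse (A : set X) (n : nat) : contracting_set C A ->
  (forall b, exists p, nearest A b p) -> A (f 0) -> A (f n) ->
  forall j p, (j <= n)%N -> nearest A (f j%:Z) p -> d (f j) p <= D2.
Proof.
move=> ctr near A0 An j p jn hp.
have C0 := C_gt0; have l0 : 0 <= lam by apply: lam_ge0 f_upper.
have mR : 0 < m%:R :> R by rewrite ltr0n.
have r0 : 0 <= rho by rewrite mulr_ge0 ?ler0n.
have W0 : 0 <= W by apply: divr_ge0; [lra|exact: ltW].
have Cm : C / m%:R <= tau / 2.
  have q0 : 0 <= 2 * C / tau by apply: divr_ge0; [lra|exact: ltW].
  have /andP[_] := truncn_itv q0; rewrite -/m ltr_pdivrMr// => h.
  by rewrite ler_pdivrMr// mulrC; lra.
have [q hq] := choice (fun i : nat => near (f i%:Z)).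
pose h (i : nat) := d (f i) (q i).
have hle (a : X) (i : nat) : A a -> h i <= d (f i) a by exact: (hq i).2.
have hp' : d (f j) p <= h j by exact: hp.2 (hq j).1.
suff : h j <= D2 by lra.
have [small|big] := leP (h j) rho; first by rewrite /D2 ler_wpDl// mulr_ge0.
have stepf (i k : nat) : (i <= k)%N -> d (f i) (f k) <= lam * (k - i)%:R.
  by move=> ik; apply: le_trans (f_upper _ _) _; rewrite distz_nat.
have exl : exists i, (i <= j)%N && (h i <= rho).
  by exists 0%N; rewrite leq0n/=; apply: le_trans (hle _ _ A0) _; rewrite mdistxx.
have exr : exists i, (j <= i)%N && (h i <= rho).
  by exists n; rewrite jn/=; apply: le_trans (hle _ _ An) _; rewrite mdistxx.
(* The excursion around [j] is bounded by [u] and [v], the closest indices on either side at which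
   the orbit is within [rho] of [A]. *)
have [u /andP[uj hu] umax] := ex_maxnP exl (fun i ij => proj1 (andP ij)).
have [v /andP[jv hv] vmin] := ex_minnP exr.
have uj' : (u < j)%N.
  by rewrite ltn_neqAle uj andbT; apply/eqP => e; move: hu; rewrite e leNgt big.
have jv' : (j < v)%N.
  by rewrite ltn_neqAle jv andbT; apply/eqP => e; move: hv; rewrite -e leNgt big.
have far (i : nat) : (u < i < v)%N -> rho < h i.
  move=> ui; rewrite ltNge; apply/negP => hi.
  case/andP: ui => ui iv; have [ij|ij] := leqP i j.
    by have := umax i; rewrite ij hi leqNgt ui => /(_ isT).
  by have := vmin i; rewrite (ltnW ij) hi leqNgt iv => /(_ isT).
(* During the excursion, [m] steps move the orbit by at most [rho], less than its distance to [A],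
   so [drift] bounds the motion of the projection by [C]. *)
have := @walk _ X q C m u.+1 v isT (ltW C0) _ (leq_ltn_trans uj jv').
have stepq (i k : nat) : (u < i < v)%N -> (i <= k <= i + m)%N -> d (q i) (q k) <= C.
  move=> ui /andP[ik ki]; apply: (drift ctr (hq i) (hq k)).
  apply: le_lt_trans (far i ui); apply: le_trans (stepf _ _ ik) _.
  by rewrite /rho mulrC ler_wpM2r// ler_nat leq_subLR.
move=> /(_ stepq) wk.
pose l : R := (v - u.+1)%:R.
have l_ge0 : 0 <= l by exact: ler0n.
have hu1 : h u.+1 <= rho + lam.
  apply: le_trans (hle _ _ (hq u).1) _.
  have := metric_triangle (f u.+1) (f u) (q u); have := stepf u u.+1 (leqnSn u).
  by rewrite subSnn mulr1 (metric_sym (f u) (f _)) -/(h u); lra.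
have tl : tau * l <= d (f u.+1) (f v).
  by apply: le_trans (f_lower _ _); rewrite distz_nat// (leq_ltn_trans uj jv').
(* The ends of the excursion are at least [tau * l] apart, but a route along [A] has length at most
   [2 * rho + lam + C + tau / 2 * l]. *)
have lW : l <= W.
  rewrite /W ler_pdivlMr//.
  have : C * (l / m%:R + 1) <= tau / 2 * l + C.
    by rewrite mulrDr mulr1 lerD2r mulrCA mulrC ler_wpM2r.
  move: wk; rewrite -/l => wk.
  have := metric_triangle (f u.+1) (q u.+1) (f v).
  have := metric_triangle (q u.+1) (q v) (f v).
  rewrite (metric_sym (q v) (f v)) -/(h v) -/(h u.+1); lra.
apply: le_trans (hle _ _ (hq v).1) _.
have := metric_triangle (f j) (f v) (q v); have := stepf j v jv.
rewrite -/(h v) => s1 s2.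
have : lam * (v - j)%:R <= lam * W.
  by rewrite ler_wpM2l//; apply: le_trans lW; rewrite ler_nat leq_sub2l.
rewrite /D2; lra.
Qed.

(** The orbit piece and the path are at bounded Hausdorff distance: [morse] gives one half, and for
    the other the parameters of the projections run over the whole path with jumps at most
    [2 * D2 + lam]. *)
Lemma contracting_orbit_of_path : exists C', forall (n : nat) (g : R -> X),
  geodesic_path (f 0) (f n) g ->
  contracting_set C (g @` `[0, d (f 0) (f n)]) ->
  contracting_set C' [set f i%:Z | i in [set i : nat | (i <= n)%N]].
Proof.
have C0 := C_gt0; have l0 : 0 <= lam by apply: lam_ge0 f_upper.
have D20 : 0 <= D2.
  have r0 : 0 <= rho by rewrite mulr_ge0 ?ler0n.
  apply: addr_ge0 => //; apply: mulr_ge0 => //.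
  by apply: divr_ge0; [lra|exact: ltW].
pose D := 3 * D2 + lam.
exists (2 * (14 * C + D + 4 * C + 4 * D)) => n g hg ctr.
have near b := nearest_path b hg.
have [g0 gL _] := hg; have L0 := mdist_ge0 (f 0) (f n).
set A := g @` _ in ctr near *.
have A0 : A (f 0) by exists 0 => //=; rewrite in_itv/= lexx.
have An : A (f n) by exists (d (f 0) (f n)) => //=; rewrite in_itv/= lexx L0.
have mo := morse ctr near A0 An.
apply: (contracting_transfer geo C0 ctr near (F := eq)).
- by rewrite /D; lra.
- by move=> a _; exists a.
- move=> a e [s /=]; rewrite in_itv/= => hs sa <-.
  have [i|t ht] := choice (_ : forall i : nat, exists t, 0 <= t <= d (f 0) (f n) /\
      nearest A (f i%:Z) (g t)).
    have [p hp] := near (f i); case: (hp) => -[t /=]; rewrite in_itv/= => ht tp _.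
    by exists t; rewrite tp.
  have step (i : nat) : (i < n)%N -> t i.+1 - t i <= 2 * D2 + lam.
    move=> i_n; apply: le_trans (ler_norm _) _.
    rewrite -(path_dist hg (ht _).1 (ht _).1).
    have := mo i.+1 _ i_n (ht _).2; have := mo i _ (ltnW i_n) (ht _).2.
    have := f_upper i i.+1; rewrite distz_nat// subSnn mulr1 (metric_sym (f i)).
    have := metric_triangle (g (t i.+1)) (f i.+1) (g (t i)).
    have := metric_triangle (f i.+1) (f i) (g (t i)).
    by rewrite (metric_sym (g (t i.+1)) (f i.+1)); lra.
  have t0 : t 0%N = 0.
    have h := nearest_mem A0 (ht 0%N).2.
    by rewrite -(path_dist_start hg (ht 0%N).1) h mdistxx.
  have tn : t n = d (f 0) (f n).
    have h := nearest_mem An (ht n).2.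
    by have := path_dist_end hg (ht n).1; rewrite h mdistxx; lra.
  have [||i i_n ti] := @discrete_ivt R t s (2 * D2 + lam) n _ _ step; first by lra.
    by rewrite t0 tn.
  exists (f i); first by exists i.
  have := mo i _ i_n (ht _).2; have := path_dist hg (ht i).1 hs.
  have := metric_triangle a (g (t i)) (f i).
  rewrite (metric_sym (g (t i)) (f i)) -sa (metric_sym (g s) (g (t i))) /D; lra.
- move=> y [i /= i_n <-]; have [p hp] := near (f i).
  exists p; first exact: hp.1.
  split; first by have := mo i _ i_n hp; rewrite /D; lra.
  by move=> a e _ <-; rewrite mdistxx /D; lra.
by move=> a a' e e' _ _ <- <-; rewrite mdistxx /D; lra.
Qed.

End MorseOrbit.

(** * Convexity of CAT(0) metrics *)

Section EuclideanPlane.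
Context (R : realType).
Implicit Types (p q : R * R) (a b c t : R).

Lemma eucl_distE p q a : 0 <= a ->
  (p.1 - q.1) ^+ 2 + (p.2 - q.2) ^+ 2 = a ^+ 2 -> eucl_dist p q = a.
Proof. by move=> a0 e; rewrite /eucl_dist e sqrtr_sqr ger0_norm. Qed.

Lemma eucl_dist_scale p q p' q' t : 0 <= t ->
  p.1 - q.1 = t * (p'.1 - q'.1) -> p.2 - q.2 = t * (p'.2 - q'.2) ->
  eucl_dist p q = t * eucl_dist p' q'.
Proof.
move=> t0 e1 e2; rewrite /eucl_dist e1 e2 !exprMn -mulrDr sqrtrM ?sqr_ge0//.
by rewrite sqrtr_sqr ger0_norm.
Qed.

Lemma eucl_triangle_exists a b c : 0 <= a -> 0 <= b -> 0 <= c ->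
  a <= b + c -> b <= a + c -> c <= a + b ->
  exists w0 w1 w2 : R * R,
    [/\ eucl_dist w0 w1 = a, eucl_dist w1 w2 = b & eucl_dist w2 w0 = c].
Proof.
move=> a0 b0 c0 abc bac cab; have [aE|an0] := eqVneq a 0.
  exists (0, 0), (0, 0), (c, 0); split; apply: eucl_distE => //=.
  - by rewrite aE; ring.
  - by have -> : b = c; [lra|ring].
  - by ring.
(* Law of cosines: [u] is the abscissa of [w2] when the side [a] lies on the first axis. The
   triangle inequalities give [- c <= u <= c]. *)
pose u := (a ^+ 2 + c ^+ 2 - b ^+ 2) / (2 * a).
have a_gt0 : 0 < a by rewrite lt_neqAle eq_sym an0.
have ua : 2 * a * u = a ^+ 2 + c ^+ 2 - b ^+ 2.
  by rewrite /u mulrC divfK// mulf_neq0.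
have uc : u <= c.
  rewrite -(ler_pM2l (_ : 0 < 2 * a)) ?mulr_gt0// ua.
  have : 0 <= (b - a + c) * (b + a - c) by rewrite mulr_ge0//; lra.
  by lra.
have cu : - c <= u.
  rewrite -(ler_pM2l (_ : 0 < 2 * a)) ?mulr_gt0// ua.
  have : 0 <= (a + c - b) * (a + c + b) by rewrite mulr_ge0//; lra.
  by lra.
have v0 : 0 <= c ^+ 2 - u ^+ 2 by rewrite subr_sqr mulr_ge0//; lra.
exists (0, 0), (a, 0), (u, Num.sqrt (c ^+ 2 - u ^+ 2)).
split; apply: eucl_distE => //=.
- by ring.
- by rewrite sub0r sqrrN sqr_sqrtr//; lra.
- by rewrite !subr0 sqr_sqrtr//; ring.
Qed.

End EuclideanPlane.

Lemma path_rev (R : realType) (X : metricType R) (x y : X) g :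
  geodesic_path x y g -> geodesic_path y x (fun s => g (d x y - s)).
Proof.
case=> g0 gL h; rewrite /geodesic_path (metric_sym y x); split.
- by rewrite subr0.
- by rewrite subrr.
move=> s t; rewrite !in_itv/= => hs ht; rewrite h ?in_itv/=; [|lra|lra].
by rewrite (_ : _ - _ - _ = t - s) 1?distrC//; ring.
Qed.

Lemma path_isom (R : realType) (X : metricType R) (h : X -> X) (x y : X) g :
  (forall x y, d (h x) (h y) = d x y) ->
  geodesic_path x y g -> geodesic_path (h x) (h y) (h \o g).
Proof.
move=> hh [g0 gL hg]; rewrite /geodesic_path hh; split=> /=.
- by rewrite g0.
- by rewrite gL.
by move=> s t hs ht /=; rewrite hh hg.
Qed.

Section CAT0Space.
Context (R : realType) (X : metricType R) (hX : CAT0 X).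
Implicit Types (x y z p q r a b : X) (s t e : R).

Lemma CAT0_geodesic x y : exists g, geodesic_path x y g.
Proof. by have [_ [g hg _]] := hX.1 x y; exists g. Qed.

Lemma segment_path x y :
  exists2 g, geodesic_path x y g & segment x y = g @` `[0, d x y].
Proof. exact: (xgetPex set0 (hX.1 x y)). Qed.

(** In the comparison triangle the two points are exactly [t * d q r] apart, by similarity. *)
Lemma CAT0_thales p q r g1 g2 t : 0 <= t <= 1 ->
  geodesic_path p q g1 -> geodesic_path p r g2 ->
  d (g1 (t * d p q)) (g2 (t * d p r)) <= t * d q r.
Proof.
move=> ht h1 h2; have [g3 h3] := CAT0_geodesic q r.
have [||||||w0 [w1 [w2 [w01 w12 w20]]]] :=
  @eucl_triangle_exists R (d p q) (d q r) (d r p).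
- exact: mdist_ge0.
- exact: mdist_ge0.
- exact: mdist_ge0.
- by have := metric_triangle p r q; rewrite (metric_sym r q) (metric_sym p r); lra.
- by rewrite (metric_sym p q) (metric_sym r p); exact: metric_triangle.
- by rewrite (metric_sym r p); exact: metric_triangle.
have h2' := path_rev h2.
pose v (i : 'I_3) : X := nth p [:: p; q; r] i.
pose w (i : 'I_3) : R * R := nth w0 [:: w0; w1; w2] i.
pose side (i : 'I_3) : set X := nth set0 [:: g1 @` `[0, d p q];
  g3 @` `[0, d q r]; (fun s => g2 (d p r - s)) @` `[0, d r p]] i.
have hv : geodesic_triangle v side.
  by case=> [[|[|[|//]]] hi]; [exists g1|exists g3|exists (fun s => g2 (d p r - s))].
have hw : comparison_triangle v w by case=> [[|[|[|//]]] hi].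
have pq0 := mdist_ge0 p q; have pr0 := mdist_ge0 p r.
have tpq : 0 <= t * d p q <= d p q by nra.
have tpr : 0 <= t * d p r <= d p r by nra.
pose x' := ((1 - t) * w0.1 + t * w1.1, (1 - t) * w0.2 + t * w1.2).
(* The third side runs from [r] to [p], so the parameter is [1 - t] there. *)
pose y' := ((1 - (1 - t)) * w2.1 + (1 - t) * w0.1,
            (1 - (1 - t)) * w2.2 + (1 - t) * w0.2).
pose i0 : 'I_3 := @Ordinal 3 0 isT; pose i2 : 'I_3 := @Ordinal 3 2 isT.
have t0 : 0 <= t by case/andP: ht.
have t1 : 0 <= 1 - t by case/andP: ht; rewrite subr_ge0.
have -> : t * d q r = eucl_dist x' y'.
  by rewrite -w12; apply/esym/eucl_dist_scale => //=; ring.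
apply: (hX.2 v side w hv hw i0 i2).
- by exists (t * d p q); rewrite //= in_itv.
- exists (d p r - t * d p r); first by rewrite /= in_itv/= (metric_sym r p); lra.
  by congr g2; ring.
- split; first by exists t.
  rewrite (_ : d (v i0) _ = t * d p q); last exact: path_dist_start h1 tpq.
  by rewrite -w01; apply: eucl_dist_scale => //=; ring.
- split; first by exists (1 - t); [lra|].
  rewrite (_ : d (v i2) _ = (1 - t) * d r p); last first.
    rewrite (metric_sym r p) mulrBl mul1r -(path_dist_end h2 tpr); exact: metric_sym.
  by rewrite -w20; apply: eucl_dist_scale => //=; ring.
Qed.

Section Isometry.
Context (h : X -> X) (h_isom : forall x y, d (h x) (h y) = d x y).

(** The midpoints of [x, h x] and of [h x, h (h x)] are swept by [h]; apply [CAT0_thales] with apex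
    [h x]. *)
Lemma midpoint_displacement x : exists m, d m (h m) <= d x (h (h x)) / 2.
Proof.
have [g hg] := CAT0_geodesic x (h x).
have := @CAT0_thales _ _ _ _ _ (1 / 2) _ (path_rev hg) (path_isom h_isom hg).
rewrite h_isom (metric_sym (h x) x) /= => /(_ ltac:(lra)) th.
exists (g (1 / 2 * d x (h x))); move: th.
rewrite (_ : d x (h x) - 1 / 2 * d x (h x) = 1 / 2 * d x (h x)); last by field.
by lra.
Qed.

(** The diagonal [k] from [a] to [h b] splits the quadrilateral into two triangles, contributing
    [t * d b (h b)] and [(1 - t) * d a (h a)]. *)
Lemma path_displacement a b g s e : geodesic_path a b g -> 0 <= s <= d a b ->
  d a (h a) <= e -> d b (h b) <= e -> d (g s) (h (g s)) <= e.
Proof.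
move=> hg hs ae be; set L := d a b in hs.
have [t ht ts] : exists2 t, 0 <= t <= 1 & s = t * L.
  have [L0|L0] := eqVneq L 0.
    by exists 0; [lra|rewrite L0 mulr0; move: hs; rewrite L0; lra].
  have Lp : 0 < L by rewrite lt_neqAle eq_sym L0 mdist_ge0.
  exists (s / L); last by rewrite divfK.
  by case/andP: hs => s0 sL; apply/andP; split; 
    [exact: divr_ge0 s0 (ltW Lp)|rewrite ler_pdivrMr// mul1r].
have [k hk] := CAT0_geodesic a (h b).
have th1 := CAT0_thales ht hg hk.
have := @CAT0_thales _ _ _ _ _ (1 - t) _ (path_rev hk) (path_rev (path_isom h_isom hg)).
rewrite /= (metric_sym (h b) a) (metric_sym (h b) (h a)) h_isom -/L.
move=> /(_ ltac:(lra)).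
rewrite (_ : d a (h b) - (1 - t) * d a (h b) = t * d a (h b)); last by ring.
rewrite (_ : L - (1 - t) * L = t * L); last by ring.
rewrite -/L -ts in th1 *.
move=> th2; apply: le_trans (metric_triangle _ (k (t * d a (h b))) _) _.
by nra.
Qed.

End Isometry.
End CAT0Space.

(** * Orbits of isometries *)

Section Orbits.
Context (R : realType) (X : metricType R) (g : self_isometry X).
Implicit Types (x y z : X) (i j : int) (m n k : nat).

Local Notation G := (isom_exp g).

Lemma isom_expS i x : G (i + 1) x = g (G i x).
Proof.
case: i => [n|[|n]].
- by rewrite (_ : n%:Z + 1 = n.+1)//; lia.
- by rewrite (_ : Negz 0 + 1 = 0)//= isom_invK.
- by rewrite (_ : Negz n.+1 + 1 = Negz n); [rewrite /= isom_invK|lia].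
Qed.

Lemma isom_expD i j x : G (i + j) x = G i (G j x).
Proof.
elim/int_rect: i => [|n IH|n IH]; first by rewrite add0r.
  by rewrite (_ : n.+1%:Z + j = n%:Z + j + 1); [rewrite isom_expS IH|lia].
apply: (can_inj (isom_funK g)); rewrite -!isom_expS.
by rewrite (_ : - n.+1%:Z + j + 1 = - n%:Z + j) ?IH; [congr (G _ _)|]; lia.
Qed.

Lemma isom_exp_dist i x y : d (G i x) (G i y) = d x y.
Proof.
elim/int_rect: i => [//|n IH|n IH].
  by rewrite -addn1 PoszD !isom_expS isom_dist.
rewrite -(isom_dist g) -!isom_expS (_ : - n.+1%:Z + 1 = - n%:Z)//; lia.
Qed.

Lemma orbit_dist i j x : d (G i x) (G j x) = d x (G (j - i) x).
Proof. by rewrite -[in RHS](isom_exp_dist i) -isom_expD addrC subrK. Qed.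

Lemma displacement_mul m n x : d x (G (m * n)%N x) <= m%:R * d x (G n x).
Proof.
elim: m => [|m IH]; first by rewrite mul0n mul0r mdistxx.
rewrite mulSn PoszD isom_expD -natr1 mulrDl mul1r addrC.
apply: le_trans (metric_triangle _ (G n x) _) _.
by rewrite isom_exp_dist lerD2l.
Qed.

Section PositiveTranslationLength.
Context (tau_gt0 : 0 < translation_length g).
Local Notation tau := (translation_length g).

(* translation_length falls back on 0 when the limit does not exist. *)
Lemma translation_length_cvg x :
  (fun n : nat => d x (G n x) / n%:R) @ \oo --> tau.
Proof.
move: x; have [ex|nex] := pselect (exists t : R, forall x : X,
    (fun n : nat => d x (G n x) / n%:R) @ \oo --> t).
  exact: (xgetPex 0 ex).
move: tau_gt0; rewrite /translation_length xgetPN ?ltxx// => t ht.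
by apply: nex; exists t.
Qed.

Lemma translation_length_near x (e : R) : 0 < e ->
  exists N, forall n, (N <= n)%N -> `|tau - d x (G n x) / n%:R| < e.
Proof.
move=> e0; have /cvgrPdist_lt/(_ e e0)[N _ hN] := translation_length_cvg x.
by exists N => n; exact: hN.
Qed.

(** Along multiples of [n] the ratio never exceeds its value at [n], so neither does its limit. *)
Lemma translation_length_le x n : tau * n%:R <= d x (G n x).
Proof.
case: n => [|n]; first by rewrite mulr0 mdist_ge0.
have n0 : 0 < n.+1%:R :> R by rewrite ltr0n.
rewrite -ler_pdivlMr// leNgt; apply/negP => lt.
have [|N hN] := @translation_length_near x (tau - d x (G n.+1 x) / n.+1%:R).
  by rewrite subr_gt0.
have /hN : (N <= N.+1 * n.+1)%N by nia.
rewrite ltNge => /negP; apply; apply: le_trans (ler_norm _).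
rewrite lerD2l lerN2 natrM invfM mulrA ler_pM2r ?invr_gt0//.
by rewrite ler_pdivrMr ?ltr0n// mulrC displacement_mul.
Qed.

Lemma orbit_lower x i j : tau * `|i - j|%:~R <= d (G i x) (G j x).
Proof.
wlog ij : i j / i <= j => [hw|].
  by have [/hw//|/ltW/hw] := leP i j; rewrite distrC metric_sym.
rewrite orbit_dist distrC.
have : 0 <= j - i by rewrite subr_ge0.
by case: (j - i) => // n _; rewrite ger0_norm//; exact: translation_length_le.
Qed.

Lemma orbit_upper x i j : d (G i x) (G j x) <= d x (g x) * `|i - j|%:~R.
Proof.
wlog ij : i j / i <= j => [hw|].
  by have [/hw//|/ltW/hw] := leP i j; rewrite distrC metric_sym.
rewrite orbit_dist distrC.
have : 0 <= j - i by rewrite subr_ge0.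
case: (j - i) => // n _; rewrite ger0_norm// mulrC.
by have := displacement_mul n 1 x; rewrite muln1.
Qed.

(** This settles the first half of [contracting] at every base point. *)
Lemma orbit_quasi_isometric x :
  quasi_isometric_embedding_int (fun i => G i x).
Proof.
have l0 := mdist_ge0 x (g x); have ti : 0 < tau^-1 by rewrite invr_gt0.
exists (1 + d x (g x) + tau^-1), 0; split => // [|i j]; first by lra.
have n0 : 0 <= `|i - j|%:~R :> R by rewrite ler0z.
rewrite subr0 addr0; apply/andP; split.
  apply: le_trans (orbit_lower x i j); rewrite ler_wpM2r//.
  rewrite -[leRHS]invrK lef_pV2 ?posrE//; lra.
by apply: le_trans (orbit_upper x i j) _; rewrite ler_wpM2r//; lra.
Qed.

Section CAT0.
Context (hX : CAT0 X).

(** Each midpoint halves both the exponent of [g] and the bound on the displacement. *)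
Lemma displacement_pow2 k x : exists z, d z (g z) <= d x (G (2 ^ k)%N x) / 2 ^+ k.
Proof.
elim: k x => [|k IH] x; first by exists x; rewrite expr0 divr1.
have [m hm] := midpoint_displacement hX (isom_exp_dist (2 ^ k)%N) x.
have [z hz] := IH m; exists z; apply: le_trans hz _.
rewrite ler_pdivrMr ?exprn_gt0// exprS invfM mulrA divfK ?gt_eqF ?exprn_gt0//.
by rewrite expnS mul2n -addnn PoszD isom_expD.
Qed.

Lemma displacement_inf x (e : R) : 0 < e -> exists z, d z (g z) <= tau + e.
Proof.
move=> e0; have [N hN] := translation_length_near x e0.
have [z hz] := displacement_pow2 N x; exists z; apply: le_trans hz _.
have := hN (2 ^ N)%N (ltnW (@ltn_expl 2 N isT)).
by rewrite natrX ltr_norml => /andP[h _]; lra.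
Qed.

Lemma displacement_inf_near_orbit x (C e : R) : 0 < C -> 0 < e ->
  contracting_set C (range (fun i => G i x)) ->
  exists y, d x y <= 2 * C /\ d y (g y) <= tau + e.
Proof.
move=> C0 e0 ctr; have [z hz] := displacement_inf x e0.
(* With this [n], the geodesic is too long for the second case of [approach_or_shrink], which would
   give [d z (G n z) <= 4 * d z x + 8 * C]. *)
pose n := (Num.trunc ((4 * d z x + 8 * C) / tau)).+1.
have nP : 4 * d z x + 8 * C < tau * n%:R.
  have q0 : 0 <= (4 * d z x + 8 * C) / tau.
    by apply: divr_ge0; [have := mdist_ge0 z x; lra|exact: ltW].
  by have /andP[_] := truncn_itv q0; rewrite ltr_pdivrMr// [ltRHS]mulrC.
have ln := translation_length_le z n.
have near := nearest_range tau_gt0 (orbit_lower x).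
have [p hp] := near z; have [q hq] := near (G n z).
have zp : d z p <= d z x by apply: hp.2; exists 0.
have zq : d (G n z) q <= d z x.
  by rewrite -(isom_exp_dist n z); apply: hq.2; exists n.
have [k hk] := CAT0_geodesic hX z (G n z).
have [[s [_ [hs [i _ <-] si]]]|pq] :=
  approach_or_shrink C0 ctr near hk hp hq; last first.
  have := metric_triangle z p (G n z); have := metric_triangle p q (G n z).
  by rewrite (metric_sym q (G n z)); lra.
(* Powers of [g] commute with [g], so translating back towards [x] preserves the displacement. *)
exists (G (- i) (k s)); split.
  by rewrite -(isom_exp_dist i) -isom_expD subrr metric_sym.
have comm j y : d (G j y) (g (G j y)) = d y (g y).
  by rewrite -isom_expS isom_expD isom_exp_dist.
by rewrite comm; apply: (path_displacement hX (isom_dist g) hk hs); rewrite ?comm.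
Qed.

(** The radius [2 * C] does not depend on [e], so the minimum of the displacement over one compact
    ball is at most [tau + e] for every [e > 0]. *)
Lemma contracting_displacement_attained : proper_space X -> contracting g ->
  exists y, d y (g y) = tau.
Proof.
move=> pX [x _ [C0 ctr0]]; pose C := Num.max 1 C0.
have C1 : 1 <= C by rewrite le_max lexx.
have ctr : contracting_set C (range (fun i => G i x)).
  by apply: contracting_set_le ctr0; rewrite le_max lexx orbT.
pose K := [set y | d x y <= 2 * C].
have Kx : K !=set0 by exists x; rewrite /K/= mdistxx; lra.
have cont : continuous (fun y => d y (g y)).
  apply: (@lipschitz_continuous _ _ _ 2) => y z; rewrite ler_norml.
  have := metric_triangle y z (g y); have := metric_triangle z (g z) (g y).
  have := metric_triangle z y (g z); have := metric_triangle y (g y) (g z).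
  by rewrite (metric_sym (g z)) isom_dist (metric_sym z y); lra.
have [y _ hy] := compact_EVT_min Kx (pX x _) (continuous_subspaceT cont).
exists y; apply/eqP; rewrite eq_le; apply/andP; split; last first.
  by have := translation_length_le y 1; rewrite mulr1.
apply/ler_addgt0Pr => e e0.
have [|z [xz ze]] := displacement_inf_near_orbit _ e0 ctr; first by lra.
by apply: le_trans ze; apply: hy; rewrite inE.
Qed.

Lemma contracting_of_segments x C :
  (forall n, (1 <= n)%N -> contracting_set C (segment x (G n x))) ->
  contracting g.
Proof.
move=> h; exists x; first exact: orbit_quasi_isometric.
have C1 : 0 < Num.max 1 C by rewrite lt_max ltr01.
have [C' hC'] := contracting_orbit_of_path (CAT0_geodesic hX) tau_gt0
  (orbit_lower x) (orbit_upper x) C1.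
exists C'; apply/contracting_setP => c r b1 b2 p1 p2 rc cb1 cb2.
move=> [[i _ <-] hi] [[j _ <-] hj].
(* Translation by [G k] moves the indices [i] and [j] into the range from 0 to [n], where points
   nearest in the whole orbit stay nearest in the finite piece; the successor ensures [1 <= n]. *)
pose k := (`|i| + `|j|)%N; pose n := (k + k).+1.
have [ki kj] : `|(k%:Z + i)%R|%N%:Z = k%:Z + i /\ `|(k%:Z + j)%R|%N%:Z = k%:Z + j.
  by rewrite /k; lia.
have [kin kjn] : (`|(k%:Z + i)%R| <= n)%N /\ (`|(k%:Z + j)%R| <= n)%N.
  by rewrite /n /k; lia.
have [p hp sp] := segment_path hX x (G n x).
have ctr : contracting_set (Num.max 1 C) (p @` `[0, d x (G n x)]).
  by rewrite -sp; apply: contracting_set_le (h n isT); rewrite le_max lexx orbT.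
have shift y l : d (G k y) (G l x) = d y (G (l - k%:Z) x).
  by rewrite -[RHS](isom_exp_dist k) -isom_expD addrC subrK.
have /contracting_setP/(_ (G k c) r (G k b1) (G k b2) (G k (G i x)) (G k (G j x))) :=
  hC' n p hp ctr.
rewrite !isom_exp_dist; apply => //.
- by move=> _ [l _ <-]; rewrite shift; apply: rc; exists (l%:Z - k%:Z).
- split; first by exists `|(k%:Z + i)%R|%N => //; rewrite ki isom_expD.
  by move=> _ [l _ <-]; rewrite isom_exp_dist shift; apply: hi; exists (l%:Z - k%:Z).
- split; first by exists `|(k%:Z + j)%R|%N => //; rewrite kj isom_expD.
  by move=> _ [l _ <-]; rewrite isom_exp_dist shift; apply: hj; exists (l%:Z - k%:Z).
Qed.

Lemma segments_of_contracting : contracting g ->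
  exists x C, forall n, (1 <= n)%N -> contracting_set C (segment x (G n x)).
Proof.
move=> [x _ [C ctr]]; exists x.
have C1 : 0 < Num.max 1 C by rewrite lt_max ltr01.
have [|C' hC'] := contracting_path_of_line (CAT0_geodesic hX) tau_gt0
  (orbit_lower x) (orbit_upper x) C1.
  by apply: contracting_set_le ctr; rewrite le_max lexx orbT.
exists C' => n _; have [p hp ->] := segment_path hX x (G n x).
exact: hC' n p hp.
Qed.

End CAT0.
End PositiveTranslationLength.
End Orbits.

Theorem corollary1p7 (R : realType) (X : metricType R) (hX : CAT0 X)
    (g : self_isometry X) (hpar : parabolic g) (htau : 0 < translation_length g) :
  (contracting g <->
    exists (x : X) (C : R), forall n : nat, (1 <= n)%N ->
      contracting_set C (segment x (isom_exp g n x))) /\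
  (complete_space X -> proper_space X -> ~ contracting g).
Proof.
split; first split.
- exact: segments_of_contracting.
- by move=> [x [C]]; exact: contracting_of_segments.
move=> _ pX /(contracting_displacement_attained htau hX pX)[y hy].
suff : Min g y by rewrite hpar.
exact: hy.
Qed.
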